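(* Every element of $\mathcal{A}$ can be written as a shuffle polynomial in iterated areas, i.e. as a finite real linear combination of the empty word $e$ and shuffle products $A_1 ⧢ \cdots ⧢ A_n$ ($n\ge 1$), where each $A_i$ is of the form $\mathrm{area}(t)$ for some $t\in\mathcal{M}_A$.
   Context: Let $A$ be a finite alphabet, $W_A$ the set of all words over $A$ including the empty word $e$, and $\mathcal{A}$ the real vector space with basis $W_A$. For $f\in\mathcal{A}$, $\langle f,e\rangle$ denotes the coefficient of $e$ in $f$. Juxtaposition denotes concatenation of words, extended bilinearly. The (left) half shuffle $\prec:\mathcal{A}\times\mathcal{A}\to\mathcal{A}$ is the bilinear map determined on words by: $e\prec w=0$ for every word $w$ (including $w=e$); $u\prec e=u$ for every non-empty word $u$; $a\prec w=aw$ for every letter $a$ and word $w$; and recursively $(au)\prec w=a(u\prec w+w\prec u)$ for every letter $a$, non-empty word $u$ and word $w$. The shuffle product is $f ⧢ g = f\prec g+g\prec f+\langle f,e\rangle\langle g,e\rangle e$; it is associative and commutative. The operator $\mathrm{area}:\mathcal{A}\times\mathcal{A}\to\mathcal{A}$ is $\mathrm{area}(f,g)=f\prec g-g\prec f$. $\mathcal{M}_A$ is the free magma over $A$ (binary planar rooted trees with leaves labelled in $A$): the smallest set containing $A$ and containing $(t',t'')$ whenever $t',t''\in\mathcal{M}_A$. The map $\mathrm{area}:\mathcal{M}_A\to\mathcal{A}$ is defined by $\mathrm{area}(a)=a$ for $a\in A$ and $\mathrm{area}((t',t''))=\mathrm{area}(\mathrm{area}(t'),\mathrm{area}(t''))$.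 An iterated area is an element of the form $\mathrm{area}(t)$ with $t\in\mathcal{M}_A$. *)

(* Defs.v *)
From mathcomp Require Import all_boot all_order all_algebra.
From mathcomp Require Import finmap monalg reals.

Set Implicit Arguments.
Unset Strict Implicit.
Unset Printing Implicit Defensive.

Import GRing.Theory.
Local Open Scope ring_scope.

(* The vector space with basis the words over A. As the monoid algebra of the
   free monoid {fmonom A}, its ring product is the concatenation. *)
Notation words_alg R A := {malg R[{fmonom A}]}.

Section HalfShuffle.
Variables (R : comNzRingType) (A : choiceType).
Implicit Types (a : A) (u w : seq A) (f g h : words_alg R A).

Definition word u : words_alg R A := << FMonom u >>.

(* The recursion is not structural, as one of the two calls exchanges the
   arguments; n is fuel, and half_wordE gives the defining equations. *)
Fixpoint half_word_rec (n : nat) u w : words_alg R A :=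
  match n, u, w with
  | 0, _, _ | _, [::], _ => 0
  | _.+1, _ :: _, [::] => word u
  | _.+1, [:: a], _ :: _ => word [:: a] * word w
  | n'.+1, a :: u', _ :: _ =>
      word [:: a] * (half_word_rec n' u' w + half_word_rec n' w u')
  end.

Definition half_word u w := half_word_rec (size u + size w) u w.

Definition half f g : words_alg R A :=
  \sum_(u <- msupp f) \sum_(w <- msupp g) (f@_u * g@_w) *: half_word u w.

Definition shuffle f g : words_alg R A :=
  half f g + half g f + (f@_(FMonom [::]) * g@_(FMonom [::])) *: word [::].

Definition area f g : words_alg R A := half f g - half g f.

Lemma half_word_rec_fuel m n u w : (size u + size w <= m)%N ->
  (size u + size w <= n)%N -> half_word_rec m u w = half_word_rec n u w.
Proof.
elim: m n u w => [|m IH] [|n] [|a u] [|b w]; try by [].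
all: try by move=> _ _; reflexivity.
case: u => [|c u]; first by move=> _ _; reflexivity.
have recE k : half_word_rec k.+1 [:: a, c & u] (b :: w) = word [:: a] *
    (half_word_rec k (c :: u) (b :: w) + half_word_rec k (b :: w) (c :: u)).
  by reflexivity.
rewrite !recE [size [:: a, c & u]]/= addSn !ltnS => lem len.
rewrite (IH n (c :: u)) ?(IH n (b :: w)) //.
all: by rewrite [(size (b :: w) + _)%N]addnC.
Qed.

Lemma word_cat u w : word (u ++ w) = word u * word w.
Proof. by rewrite /word malgM_def fgmulUU mulr1 /mmul /= fmmulE. Qed.

Lemma half_wordE : [/\ forall w, half_word [::] w = 0,
  forall u, u != [::] -> half_word u [::] = word u,
  forall a w, half_word [:: a] w = word (a :: w) &
  forall a u w, u != [::] ->
    half_word (a :: u) w = word [:: a] * (half_word u w + half_word w u)].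
Proof.
have half0 w : half_word [::] w = 0.
  by rewrite /half_word; case: (_ + _)%N => [|n]; reflexivity.
have half1 u : u != [::] -> half_word u [::] = word u.
  by case: u => [|a [|b u]]; try by []; move=> _; reflexivity.
split=> [||a w|a u w u0].
- exact: half0.
- exact: half1.
- case: w => [|b w]; first by apply: half1.
  by rewrite (word_cat [:: a] (b :: w)); reflexivity.
case: w => [|c w].
  by rewrite half0 addr0 !half1 // -(word_cat [:: a]).
case: u u0 => [|b u] u0; first by case/negP: u0; exact: eqxx.
transitivity (word [:: a] *
    (half_word_rec (size (b :: u) + size (c :: w)) (b :: u) (c :: w)
     + half_word_rec (size (b :: u) + size (c :: w)) (c :: w) (b :: u))).
  by reflexivity.
by rewrite /half_word (addnC (size (c :: w))).
Qed.

Lemma half_finsupp (d1 d2 : {fset {fmonom A}}) f g :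
  (msupp f `<=` d1)%fset -> (msupp g `<=` d2)%fset ->
  half f g = \sum_(u <- d1) \sum_(w <- d2) (f@_u * g@_w) *: half_word u w.
Proof.
move=> le1 le2; rewrite /half (big_fset_incl _ le1) /=; last first.
  move=> u _ /mcoeff_outdom ->.
  by rewrite big1_seq // => w _; rewrite mul0r scale0r.
apply: eq_bigr => u _; apply: (big_fset_incl _ le2) => w _ /mcoeff_outdom ->.
by rewrite mulr0 scale0r.
Qed.

Lemma half_word_word u w : half (word u) (word w) = half_word u w.
Proof. by rewrite /half !msuppU1 !big_seq_fset1 !mcoeffUU mulr1 scale1r. Qed.

Lemma halfDZl c f g h : half (c *: f + g) h = c *: half f h + half g h.
Proof.
pose d := (msupp (c *: f + g) `|` msupp f `|` msupp g)%fset.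
have sub1 : (msupp (c *: f + g) `<=` d)%fset by rewrite /d -fsetUA fsubsetUl.
have sub2 : (msupp f `<=` d)%fset by rewrite /d fsetUAC fsubsetUr.
have sub3 : (msupp g `<=` d)%fset by rewrite /d fsubsetUr.
rewrite !(@half_finsupp d (msupp h)) // scaler_sumr -big_split /=.
apply: eq_bigr => u _; rewrite scaler_sumr -big_split; apply: eq_bigr => w _ /=.
by rewrite scalerA -scalerDl mulrA -mulrDl mcoeffD mcoeffZ.
Qed.

Lemma halfDZr c f g h : half h (c *: f + g) = c *: half h f + half h g.
Proof.
pose d := (msupp (c *: f + g) `|` msupp f `|` msupp g)%fset.
have sub1 : (msupp (c *: f + g) `<=` d)%fset by rewrite /d -fsetUA fsubsetUl.
have sub2 : (msupp f `<=` d)%fset by rewrite /d fsetUAC fsubsetUr.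
have sub3 : (msupp g `<=` d)%fset by rewrite /d fsubsetUr.
rewrite !(@half_finsupp (msupp h) d) // scaler_sumr -big_split /=.
apply: eq_bigr => u _; rewrite scaler_sumr -big_split; apply: eq_bigr => w _ /=.
by rewrite scalerA -scalerDl mulrCA -mulrDr mcoeffD mcoeffZ.
Qed.

End HalfShuffle.

Inductive magma (A : Type) : Type :=
| Leaf of A
| Node of magma A & magma A.

Fixpoint area_tree (R : comNzRingType) (A : choiceType) (t : magma A) :
    words_alg R A :=
  match t with
  | Leaf a => word R [:: a]
  | Node t1 t2 => area (area_tree R t1) (area_tree R t2)
  end.

(* The left-nested shuffle product of area(t), area(t_1), ..., area(t_k) for
   ts = [:: t_1; ...; t_k]; having t apart from ts keeps it non-empty. *)
Definition shuffle_areas (R : comNzRingType) (A : choiceType)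
    (t : magma A) (ts : seq (magma A)) : words_alg R A :=
  foldl (@shuffle R A) (area_tree R t) [seq area_tree R t' | t' <- ts].

(* Main.v *)
(* Modulo shuffle polynomials in iterated areas, put
   Z_i = x_i < (shuffle of the x_j, j <> i) for iterated areas x_1, ..., x_k,
   where < is the half shuffle. The Zinbiel identity (f < g) < h = f < (g sh h)
   gives Z_1 - Z_2 = area(x_1, x_2) < (x_3 sh ... sh x_k), which vanishes by
   induction on k, so all Z_i agree; their sum is x_1 sh ... sh x_k, which
   vanishes as well, so k Z_1, and hence Z_1, does. A word a u being a < u, it
   follows by induction on the length that every word is such a polynomial. *)
From HB Require Import structures.
From Pilot Require Import Defs.
From mathcomp Require Import all_boot all_order all_algebra.
From mathcomp Require Import finmap monalg reals.
From mathcomp Require Import zify.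

Import GRing.Theory Num.Theory.
Local Open Scope ring_scope.

Set Implicit Arguments.
Unset Strict Implicit.
Unset Printing Implicit Defensive.

(** * Linear combinations of a fixed vector and a family *)

Section Span.
Variables (R : nzRingType) (V : lmodType R) (I : Type) (e : V) (p : I -> V).
Implicit Types (x y : V).

Definition in_span x :=
  exists (c : R) (s : seq (R * I)), x = c *: e + \sum_(m <- s) m.1 *: p m.2.

Lemma in_spanDZ c x y : in_span x -> in_span y -> in_span (c *: x + y).
Proof.
move=> [c1 [s1 ->]] [c2 [s2 ->]].
exists (c * c1 + c2), ([seq (c * m.1, m.2) | m <- s1] ++ s2).
rewrite big_cat big_map scalerDl -scalerA scalerDr addrACA; congr (_ + (_ + _)).
by rewrite scaler_sumr; apply: eq_bigr => m _; rewrite scalerA.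
Qed.

Lemma in_span0 : in_span 0.
Proof. by exists 0, [::]; rewrite big_nil scale0r addr0. Qed.

Lemma in_span_unit : in_span e.
Proof. by exists 1, [::]; rewrite big_nil scale1r addr0. Qed.

Lemma in_span_gen i : in_span (p i).
Proof. by exists 0, [:: (1, i)]; rewrite big_seq1 scale0r scale1r add0r. Qed.

Lemma in_spanZ c x : in_span x -> in_span (c *: x).
Proof. by move=> Px; rewrite -[c *: x]addr0; apply/in_spanDZ/in_span0. Qed.

Lemma in_spanD x y : in_span x -> in_span y -> in_span (x + y).
Proof. by move=> Px Py; rewrite -[x]scale1r; apply: in_spanDZ. Qed.

Lemma in_spanB x y : in_span x -> in_span y -> in_span (x - y).
Proof. by move=> Px Py; rewrite addrC -scaleN1r; apply: in_spanDZ. Qed.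

Lemma in_span_addZ c x : in_span (x + c *: e) -> in_span x.
Proof.
move=> Pxe; rewrite -[x](addrK (c *: e)); apply: in_spanB => //.
exact/in_spanZ/in_span_unit.
Qed.

(** Counting step: one more congruence with [z] modulo the span raises the multiple of [z] by
    one. *)
Lemma in_span_subS n x y z : in_span (x - z) -> in_span (y - n%:R *: z) ->
  in_span (x + y - n.+1%:R *: z).
Proof.
move=> Pxz Pyz; rewrite -natr1 scalerDl scale1r opprD [x + y]addrC addrACA.
exact: in_spanD.
Qed.

End Span.

(** Subtracting the hypotheses leaves [n.+1%:R *: x], and [n.+1%:R] is invertible in characteristic
    zero. *)
Lemma in_span_natr (R : numFieldType) (V : lmodType R) (I : Type) (e : V)
    (p : I -> V) n x y :
  in_span e p (x + y) -> in_span e p (y - n%:R *: x) -> in_span e p x.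
Proof.
move=> Pxy Pyx.
have -> : x = n.+1%:R^-1 *: (x + y - (y - n%:R *: x)).
  rewrite opprB addrACA subrr addr0 [x + _]addrC -[X in _ + X]scale1r.
  by rewrite -scalerDl natr1 scalerA mulVf ?scale1r ?pnatr_eq0.
exact/in_spanZ/in_spanB.
Qed.

(* Sealed copies of half and shuffle: comparing half f g with half g f would
   otherwise unfold both down to the monoid algebra and never end. *)
HB.lock Definition prec (R : comNzRingType) (A : choiceType)
  (f g : words_alg R A) : words_alg R A := Defs.half f g.

HB.lock Definition shuf (R : comNzRingType) (A : choiceType)
  (f g : words_alg R A) : words_alg R A := shuffle f g.

Section ShuffleAlgebra.
Variables (R : comNzRingType) (A : choiceType).
Implicit Types (a : A) (u v w : seq A) (f g h : words_alg R A).

Local Notation W := (words_alg R A).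
Local Notation word := (@word R A).
Local Notation coef0 f := (f@_(FMonom [::])).

(** * Reduction of linear identities to words *)

Lemma monalgU_word c (k : {fmonom A}) : << c *g k >> = c *: word k.
Proof.
apply/malgP => k'; rewrite mcoeffZ /Defs.word !mcoeffU mulrnAr mulr1.
by case: k => k.
Qed.

(** Words span the algebra; this proves multilinear identities one argument at a time. *)
Lemma eq_linear_words (V : lmodType R) (F G : W -> V) : linear F -> linear G ->
  (forall u, F (word u) = G (word u)) -> F =1 G.
Proof.
move=> linF linG eqFG f; rewrite [f]monalgE.
elim/big_rec: _ => [|k g _ IH].
  have lin0 (H : W -> V) : linear H -> H 0 = 0.
    by move=> /(_ (-1) 0 0); rewrite scaler0 addr0 scaleN1r addNr.
  by rewrite !lin0.
by rewrite monalgU_word linF linG eqFG IH.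
Qed.

(* {malg R[K]} is declared as an algebra for commutative K only. *)
Lemma malg_scalerAr c f g : f * (c *: g) = c *: (f * g).
Proof.
have fC : f * c%:MP = c%:MP * f.
  transitivity (fgmul f c%:MP); first by [].
  transitivity (fgmul c%:MP f); last by [].
  rewrite fgmulUg fgmulgU; apply: eq_bigr => k _.
  by rewrite mul1m mulm1 mulrC.
rewrite -(mul_malgC c g) -(mul_malgC c (f * g)).
transitivity (f * c%:MP * g); first exact: mulrA.
by rewrite fC; apply/esym; exact: mulrA.
Qed.

(** * Identities of the half shuffle and the shuffle product *)

Lemma precDZl c f g h : prec (c *: f + g) h = c *: prec f h + prec g h.
Proof. by rewrite unlock halfDZl. Qed.

Lemma precDZr c f g h : prec h (c *: f + g) = c *: prec h f + prec h g.
Proof. by rewrite unlock halfDZr. Qed.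

Lemma prec0r h : prec h 0 = 0.
Proof. by have := precDZr (-1) 0 0 h; rewrite scaler0 addr0 scaleN1r addNr. Qed.

Lemma prec_word_word u w : prec (word u) (word w) = half_word R u w.
Proof. by rewrite unlock half_word_word. Qed.

Lemma shufE f g :
  shuf f g = prec f g + prec g f + (coef0 f * coef0 g) *: word [::].
Proof. by rewrite !unlock. Qed.

Lemma prec_linearl h : linear (@prec R A ^~ h).
Proof. by move=> c f g; rewrite precDZl. Qed.

Lemma precZl c f h : prec (c *: f) h = c *: prec f h.
Proof. exact: (scalable_linear (prec_linearl h)). Qed.

Lemma precDl f g h : prec (f + g) h = prec f h + prec g h.
Proof. exact: (GRing.semilinear_linear (prec_linearl h)).2. Qed.

Lemma precBl f g h : prec (f - g) h = prec f h - prec g h.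
Proof. by rewrite -scaleN1r precDl precZl scaleN1r. Qed.

Lemma prec0l h : prec 0 h = 0.
Proof. by have := precZl 0 0 h; rewrite !scale0r. Qed.

Lemma prec_word0l f : prec (word [::]) f = 0.
Proof.
apply: (eq_linear_words (F := prec (word [::])) (G := fun=> 0)).
- by move=> c g h; rewrite precDZr.
- by move=> c g h; rewrite scaler0 addr0.
by move=> u; rewrite prec_word_word; case: (half_wordE R A).
Qed.

Lemma coef0_word u : coef0 (word u) = (u == [::])%:R.
Proof. by rewrite mcoeffU1; congr (_%:R); rewrite fmP. Qed.

Lemma shufC : commutative (@shuf R A).
Proof.
by move=> f g; rewrite !shufE [prec f g + _]addrC [coef0 f * _]mulrC.
Qed.

Lemma shufDZl c f g h :
  shuf (c *: f + g) h = c *: shuf f h + shuf g h.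
Proof.
rewrite !shufE precDZl precDZr mcoeffD mcoeffZ mulrDl scalerDl -mulrA.
by rewrite !scalerDr scalerA [X in X + _ = _]addrACA [LHS]addrACA.
Qed.

Lemma shufDZr c f g h :
  shuf h (c *: f + g) = c *: shuf h f + shuf h g.
Proof. by rewrite ![shuf h _]shufC shufDZl. Qed.

Lemma shuf_wordl u g : u != [::] ->
  shuf (word u) g = prec (word u) g + prec g (word u).
Proof.
by move=> /negPf u0; rewrite !shufE coef0_word u0 mul0r scale0r addr0.
Qed.

Lemma shuf1f : left_id (word [::]) (@shuf R A).
Proof.
apply: (eq_linear_words (F := shuf (word [::])) (G := id)) => //.
  by move=> c g h; rewrite shufDZr.
case=> [|a u].
  by rewrite !shufE prec_word0l !add0r coef0_word mulr1 scale1r.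
have [_ half1 _ _] := half_wordE R A.
by rewrite shufC shuf_wordl // prec_word0l addr0 prec_word_word half1.
Qed.

(** For [g] a non-empty word this is the defining recursion, whose sum is a full shuffle since the
    product of the coefficients of [e] vanishes. For [g] the empty word it holds because [e] is the
    shuffle unit. *)
Lemma prec_letterM a g h :
  prec (word [:: a] * g) h = word [:: a] * shuf g h.
Proof.
apply: (eq_linear_words (F := fun g => prec (word [:: a] * g) h)
          (G := fun g => word [:: a] * shuf g h)) g.
- by move=> c g1 g2; rewrite mulrDr malg_scalerAr precDZl.
- by move=> c g1 g2; rewrite shufDZl mulrDr malg_scalerAr.
move=> u; rewrite -word_cat.
apply: (eq_linear_words (F := prec (word ([:: a] ++ u)))
          (G := fun h => word [:: a] * shuf (word u) h)) h.
- by move=> c g1 g2; rewrite precDZr.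
- by move=> c g1 g2; rewrite shufDZr mulrDr malg_scalerAr.
move=> w; rewrite prec_word_word.
have [_ _ half_letter half_cons] := half_wordE R A.
have [->|u0] := eqVneq u [::].
  by rewrite shuf1f -word_cat half_letter.
by rewrite (half_cons _ _ _ u0) (shuf_wordl (word w) u0) !prec_word_word.
Qed.

Lemma prec_letter a f : prec (word [:: a]) f = word [:: a] * f.
Proof. by rewrite -[in RHS](shuf1f f) -prec_letterM -word_cat. Qed.

Lemma coef0_prec f g : coef0 (prec f g) = 0.
Proof.
(* The empty word is the unit of the monoid, so its coefficient is multiplicative for concatenation
   and vanishes behind a leading letter. *)
have E : FMonom [::] = @mone {fmonom A} by rewrite /mone /= fmoneE.
apply: (eq_linear_words (V := R^o) (F := fun f => coef0 (prec f g))
          (G := fun=> 0)) f.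
- by move=> c g1 g2; rewrite precDZl mcoeffD mcoeffZ.
- by move=> c g1 g2; rewrite scaler0 addr0.
case=> [|a u]; first by rewrite prec_word0l mcoeff0.
rewrite -cat1s word_cat prec_letterM E rmorphM /= -E coef0_word.
exact: mul0r.
Qed.

Lemma coef0_shuf f g : coef0 (shuf f g) = coef0 f * coef0 g.
Proof.
rewrite !shufE mcoeffD mcoeffD coef0_prec coef0_prec addr0 add0r.
by rewrite mcoeffZ coef0_word mulr1.
Qed.

(** * The Zinbiel identity and associativity of the shuffle product *)

(* The Zinbiel identity at given arguments: on words, the induction on total
   length needs it together with the associativity it implies. *)
Definition zinbiel_at f g h := prec (prec f g) h = prec f (shuf g h).

Lemma prec_shuf_at f g h : zinbiel_at f g h -> zinbiel_at g f h ->
  prec (shuf f g) h = prec f (shuf g h) + prec g (shuf f h).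
Proof.
move=> fgh gfh.
by rewrite (shufE f g) !precDl precZl prec_word0l scaler0 addr0 fgh gfh.
Qed.

(** Up to the [e] term, both sides expand to the sum of the half shuffles of each of [f], [g], [h]
    with the shuffle of the other two. *)
Lemma shufA_at f g h : zinbiel_at f g h -> zinbiel_at g f h ->
  zinbiel_at g h f -> zinbiel_at h g f ->
  shuf f (shuf g h) = shuf (shuf f g) h.
Proof.
move=> fgh gfh ghf hgf.
rewrite [LHS]shufE [RHS]shufE (prec_shuf_at ghf hgf) (prec_shuf_at fgh gfh).
rewrite coef0_shuf coef0_shuf mulrA (shufC h f) (shufC g f).
by rewrite [in LHS]addrA.
Qed.

(** Stripping the first letter of [u] leaves the two bracketings of a triple shuffle of smaller
    total length. *)
Lemma zinbiel_words u v w : zinbiel_at (word u) (word v) (word w).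
Proof.
have [n] := ubnP (size u + size v + size w).
elim: n u v w => // n IH [|a u] v w lt_n.
  by rewrite /zinbiel_at !prec_word0l prec0l.
have consE g : prec (word (a :: u)) g = word [:: a] * shuf (word u) g.
  by rewrite -prec_letterM -word_cat.
rewrite /zinbiel_at (consE (word v)) (consE (shuf _ _)).
apply: etrans (prec_letterM _ _ _) _; congr (_ * _).
(* The four instances permute the three words, hence the induction on total length rather than on
   [u]. *)
apply/esym/shufA_at; apply: IH; rewrite /= in lt_n; lia.
Qed.

Lemma prec_prec f g h : prec (prec f g) h = prec f (shuf g h).
Proof.
apply: (eq_linear_words (F := fun f => prec (prec f g) h)
          (G := fun f => prec f (shuf g h))) f.
- by move=> c f1 f2; rewrite !precDZl.
- by move=> c f1 f2; rewrite precDZl.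
move=> u; apply: (eq_linear_words (F := fun g => prec (prec (word u) g) h)
          (G := fun g => prec (word u) (shuf g h))) g.
- by move=> c f1 f2; rewrite precDZr precDZl.
- by move=> c f1 f2; rewrite shufDZl precDZr.
move=> v; apply: (eq_linear_words (F := prec (prec (word u) (word v)))
          (G := fun h => prec (word u) (shuf (word v) h))) h.
- by move=> c f1 f2; rewrite precDZr.
- by move=> c f1 f2; rewrite shufDZr precDZr.
exact: zinbiel_words.
Qed.

Lemma prec_shuf f g h :
  prec (shuf f g) h = prec f (shuf g h) + prec g (shuf f h).
Proof. by apply: prec_shuf_at; apply: prec_prec. Qed.

Lemma shufA : associative (@shuf R A).
Proof. by move=> f g h; apply: shufA_at; apply: prec_prec. Qed.

(** * Shuffle polynomials in iterated areas *)

HB.instance Definition _ :=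
  Monoid.isComLaw.Build W (word [::]) (@shuf R A) shufA shufC shuf1f.

(** Unlike [shuffle_areas] it admits the empty list, with value [e], so factors can be removed
    freely. *)
Definition shuffle_prod (ts : seq (magma A)) : W :=
  \big[@shuf R A/word [::]]_(t <- ts) area_tree R t.

Lemma shuffle_areasE t ts : shuffle_areas R t ts = shuffle_prod (t :: ts).
Proof.
transitivity (foldl (@shuf R A) (area_tree R t) (map (@area_tree R A) ts)).
  by rewrite [@shuf]unlock.
by rewrite foldlE -map_cons big_map.
Qed.

Lemma area_tree_Node (t1 t2 : magma A)
    (f := area_tree R t1) (g := area_tree R t2) :
  area_tree R (Node t1 t2) = prec f g - prec g f.
Proof. by rewrite unlock. Qed.

Definition area_poly f :=
  in_span (word [::]) (fun m => shuffle_areas R m.1 m.2) f.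

Lemma area_poly_prod ts : area_poly (shuffle_prod ts).
Proof.
case: ts => [|t ts].
  by rewrite /shuffle_prod big_nil; apply: in_span_unit.
by rewrite -shuffle_areasE; apply: (in_span_gen _ _ (t, ts)).
Qed.

(* The left-hand side is the sum of the Z_i for i in s, and each is congruent
   to the Z of t; moving x from s to the list ts adds one such congruence. *)
Lemma prec_prod_mod_area_poly n s t ts : (size s + size ts = n)%N ->
  (forall t' ts', (size ts' < n)%N ->
     area_poly (prec (area_tree R t') (shuffle_prod ts'))) ->
  area_poly (prec (shuffle_prod s) (shuffle_prod (t :: ts))
             - (size s)%:R *: prec (area_tree R t) (shuffle_prod (s ++ ts))).
Proof.
move=> sz IH; elim: s t ts sz => [|x s IHs] t ts sz.
  rewrite /shuffle_prod big_nil prec_word0l scale0r subr0; exact: in_span0.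
have prod_cons y l :
    shuffle_prod (y :: l) = shuf (area_tree R y) (shuffle_prod l).
  exact: big_cons.
have prod_cat l1 l2 :
    shuffle_prod (l1 ++ l2) = shuf (shuffle_prod l1) (shuffle_prod l2).
  exact: big_cat.
have shCA : left_commutative (@shuf R A) by apply: Monoid.mulmCA.
have := IHs t (x :: ts); rewrite -sz addnS => /(_ erefl).
(* Iterated areas are closed under [area]: merging [x] and [t] into one tree leaves one factor fewer
   on the right, and [prec_prec] makes this the congruence of the [Z] of [x] with that of [t]. *)
have := IH (Node x t) (s ++ ts); rewrite size_cat -sz => /(_ (leqnn _)).
rewrite !prod_cat !prod_cons area_tree_Node.
move: (area_tree R x) (area_tree R t) (shuffle_prod s) (shuffle_prod ts).
move=> X T S U; rewrite precBl !prec_prec -shufA prec_shuf.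
rewrite (shCA S T) (shCA S X) (shCA X T); exact: in_span_subS.
Qed.
End ShuffleAlgebra.

(** Strong induction on the number of factors, for all [t] at once: the [Z] of the trees in [ts] sum
    to [size ts] times that of [t] modulo polynomials. *)
Lemma area_poly_prec (R : numFieldType) (A : choiceType) (t : magma A) ts :
  area_poly (prec (area_tree R t) (shuffle_prod R ts)).
Proof.
have [n] := ubnP (size ts); elim: n t ts => // n IH t ts lt_n.
have := @prec_prod_mod_area_poly R A (size ts) ts t [::].
rewrite addn0 cats0 => /(_ erefl).
have -> : shuffle_prod R [:: t] = area_tree R t by exact: big_seq1.
have IHts (t' : magma A) ts' : (size ts' < size ts)%N ->
    area_poly (prec (area_tree R t') (shuffle_prod R ts')).
  by move=> lt_ts; apply: IH; apply: leq_trans lt_ts _.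
move/(_ IHts); apply: in_span_natr.
(* The sum of all the [Z] is the whole shuffle product up to a multiple of [e]. *)
have := area_poly_prod R (t :: ts).
rewrite /area_poly {1}/shuffle_prod big_cons shufE; exact: in_span_addZ.
Qed.

Theorem theorem4p3 (R : realType) (A : finType) (f : {malg R[{fmonom A}]}) :
  exists (c : R) (s : seq (R * (magma A * seq (magma A)))),
    f = c *: word R [::] + \sum_(m <- s) m.1 *: shuffle_areas R m.2.1 m.2.2.
Proof.
change (area_poly f); suff word_poly (u : seq A) : area_poly (word R u).
  rewrite [f]monalgE; elim/big_rec: _ => [|k g _ IH]; first exact: in_span0.
  by rewrite monalgU_word; apply: in_spanDZ => //; exact: word_poly.
elim: u => [|a u [c [s Eu]]]; first exact: in_span_unit.
rewrite -cat1s word_cat -prec_letter Eu precDZr.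
have letter_prec ts : area_poly (prec (word R [:: a]) (shuffle_prod R ts)).
  exact: (area_poly_prec R (Leaf a)).
apply: in_spanDZ.
  (* The [e] term of the polynomial for [u] is the empty shuffle product. *)
  by have := letter_prec [::]; rewrite /shuffle_prod big_nil.
elim/big_rec: _ => [|m g _ IH]; first by rewrite prec0r; exact: in_span0.
by rewrite precDZr shuffle_areasE; apply: in_spanDZ => //; exact: letter_prec.
Qed.
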